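(* Let $(Z,w)$ be a regular Poisson manifold with characteristic foliation $\mathcal F$. Then the cochain morphism $$w^\sharp:(\mathbb R,\mathcal O^*(Z),d)\to(S_{\mathcal F}(Z),\mathcal T_*(Z),-\widehat w)$$ from the de Rham complex of $Z$ to the Lichnerowicz–Poisson complex factorizes through the leafwise de Rham complex $(S_{\mathcal F}(Z),\mathfrak F^*(Z),\tilde d)$ via the cochain morphism $i^*_{\mathcal F}:(\mathbb R,\mathcal O^*(Z),d)\to(S_{\mathcal F}(Z),\mathfrak F^*(Z),\tilde d)$ (i.e. $w^\sharp$ is the composition of $i^*_{\mathcal F}$ with a cochain morphism $(S_{\mathcal F}(Z),\mathfrak F^*(Z),\tilde d)\to(S_{\mathcal F}(Z),\mathcal T_*(Z),-\widehat w)$), and accordingly the induced cohomology homomorphism $[w^\sharp]:H^*(Z)\to H^*_w(Z)$ factorizes through the leafwise de Rham cohomology: $$H^*(Z)\xrightarrow{[i^*_{\mathcal F}]}H^*_{\mathcal F}(Z)\longrightarrow H^*_w(Z).$$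
   Context: Manifolds are smooth, Hausdorff, second-countable and connected. For a regular Poisson manifold $(Z,w)$ with Poisson bivector field $w$, the map $w^\sharp:T^*Z\to TZ$ is defined by $w^\sharp(\alpha)\rfloor\beta=w(\alpha,\beta)$; its image is an involutive distribution of constant rank $T\mathcal F\subset TZ$, and the corresponding foliation $\mathcal F$ is the characteristic foliation. $S_{\mathcal F}(Z)\subset C^\infty(Z)$ is the ring of functions constant on the leaves (equivalently the centre of the Poisson algebra). $\mathcal T_r(Z)$ is the space of $r$-vector fields on $Z$ ($\mathcal T_0(Z)=C^\infty(Z)$). The Lichnerowicz–Poisson (LP) complex is $$0\to S_{\mathcal F}(Z)\to C^\infty(Z)\xrightarrow{\widehat w}\mathcal T_1(Z)\xrightarrow{\widehat w}\cdots\xrightarrow{\widehat w}\mathcal T_{\dim Z}(Z)\to0,\qquad \widehat w(\vartheta)=-[w,\vartheta],$$ with $[\cdot,\cdot]$ the Schouten–Nijenhuis bracket; its cohomology is the LP cohomology $H^*_w(Z)$. The cochain morphism $w^\sharp$ is given by $$w^\sharp(\phi)(\sigma_1,\dots,\sigma_r)=(-1)^r\phi(w^\sharp(\sigma_1),\dots,w^\sharp(\sigma_r)),\quad \phi\in\mathcal O^r(Z),\ \sigma_i\in\mathcal O^1(Z),$$ ($w^\sharp(f)=f$ for functions), and the sign convention for the Schouten–Nijenhuis bracket is the one for which $\widehat w\circ w^\sharp=-w^\sharp\circ d$. Leafwise $r$-forms are the global sections of $\bigwedge^rT\mathcal F^*\to Z$; they form $\mathfrak F^r(Z)$, $\mathfrak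 F^0(Z)=C^\infty(Z)$. The leafwise exterior differential $\tilde d$ is the Chevalley–Eilenberg differential of the Lie algebra of global sections of $T\mathcal F$ with coefficients in $C^\infty(Z)$; in coordinates $(z^\lambda;z^i)$ adapted to the foliation (leaves locally $z^\lambda=\mathrm{const}$), $\tilde d\phi=\tilde dz^k\wedge\partial_k\phi$ with $\{\tilde dz^i\}$ dual to $\{\partial_i\}$. The leafwise de Rham complex is $0\to S_{\mathcal F}(Z)\to C^\infty(Z)\xrightarrow{\tilde d}\mathfrak F^1(Z)\to\cdots\to\mathfrak F^{\dim\mathcal F}(Z)\to0$, with cohomology $H^*_{\mathcal F}(Z)$. $\mathcal O^*(Z)$ denotes exterior forms on $Z$, $H^*(Z)$ de Rham cohomology. The cochain morphism $i^*_{\mathcal F}:\mathcal O^*(Z)\to\mathfrak F^*(Z)$ is restriction of forms to $T\mathcal F$ ($dz^\lambda\mapsto0$, $dz^i\mapsto\tilde dz^i$); it satisfies $i^*_{\mathcal F}\circ d=\tilde d\circ i^*_{\mathcal F}$. *)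

(* Defs.v *)
From HB Require Import structures.
From mathcomp Require Import all_boot all_order perm all_algebra.
From mathcomp Require Import generic_quotient ring_quotient ring.
From mathcomp Require Import boolp classical_sets functions reals.
From mathcomp Require Import topology normedtype derive.

Set Implicit Arguments.
Unset Strict Implicit.
Unset Printing Implicit Defensive.

Import Order.TTheory GRing.Theory Num.Theory.
Import numFieldNormedType.Exports.

Local Open Scope classical_set_scope.
Local Open Scope ring_scope.

Section SmoothEuclidean.
Context {R : realType} {n : nat}.
Implicit Types (U : set 'rV[R]_n) (f g : 'rV[R]_n -> R^o).

Fixpoint Ck (k : nat) U f : Prop :=
  (forall x, U x -> {for x, continuous f}) /\
  if k is k'.+1 then
    forall i : 'I_n, (forall x, U x -> derivable f x 'e_i) /\
                     Ck k' U ('D_'e_i f)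
  else True.

Definition smooth_on U f := forall k, Ck k U f.

Lemma Ck_eq k U f g : open U -> (forall x, U x -> f x = g x) ->
  Ck k U f -> Ck k U g.
Proof.
move=> oU; elim: k f g => [|k IH] f g fg.
all: have fgn x : U x -> \forall y \near x, f y = g y.
1,3: by move=> Ux; near=> y; apply: fg; near: y; exact: open_nbhs_nbhs.
all: move=> [cf pf]; split=> [x Ux|//].
1,2: rewrite /prop_for /continuous_at -(fg _ Ux).
1,2: by exact: cvg_trans (near_eq_cvg (fgn x Ux)) (cf x Ux).
move=> i; have [df pfi] := pf i; split.
  by move=> x Ux; apply: near_eq_derivable (fgn x Ux) (df x Ux).
by apply: IH pfi => x Ux; apply: near_eq_derive; exact: fgn.
Unshelve. all: by end_near. Qed.

Lemma CkS k U f : Ck k.+1 U f -> Ck k U f.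
Proof.
elim: k f => [|k IH] f [cf pf]; split=> // i.
by have [df /IH] := pf i.
Qed.

Lemma Ck_cst k U (a : R) : Ck k U (fun=> a).
Proof.
elim: k a => [|k IH] a; split=> [x Ux|//].
1,2: exact: cst_continuous.
move=> i; split=> [x _|]; first exact: derivable_cst.
rewrite (_ : 'D_'e_i _ = fun=> 0) //.
by apply/funext => x; exact: derive_cst.
Qed.

Lemma CkZD k U (a : R) f g : open U -> Ck k U f -> Ck k U g ->
  Ck k U (a *: f + g).
Proof.
move=> oU; elim: k f g => [|k IH] f g [cf pf] [cg pg]; split=> [x Ux|//].
1,2: by apply: cvgD (cg x Ux); apply: cvgZr (cf x Ux).
move=> i; have [df pfi] := pf i; have [dg pgi] := pg i; split=> [x Ux|].
  by apply: derivableD (dg x Ux); apply: derivableZ (df x Ux).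
apply: Ck_eq (IH _ _ pfi pgi) => // x Ux.
have dZ := @derivableZ _ _ _ _ a _ _ (df x Ux).
have E := deriveD dZ (dg x Ux); rewrite deriveZ in E; last exact: df.
exact: esym E.
Qed.

Lemma CkM k U f g : open U -> Ck k U f -> Ck k U g -> Ck k U (f * g).
Proof.
move=> oU; elim: k f g => [|k IH] f g.
  by move=> [cf _] [cg _]; split=> [x Ux|//]; exact: cvgM (cf x Ux) (cg x Ux).
move=> Cf Cg; have [cf pf] := Cf; have [cg pg] := Cg; split=> [x Ux|i].
  exact: cvgM (cf x Ux) (cg x Ux).
have [df pfi] := pf i; have [dg pgi] := pg i; split=> [x Ux|].
  exact: derivableM (df x Ux) (dg x Ux).
pose D := (1 : R) *: (f * 'D_'e_i g) + g * 'D_'e_i f.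
apply: (@Ck_eq _ _ D) => //.
  by move=> x Ux; have := deriveM (df x Ux) (dg x Ux); rewrite /D scale1r => ->.
apply: CkZD => //; apply: IH => //; exact: CkS.
Qed.

End SmoothEuclidean.

(* Only the values of cmap on cdom, and of cinv on cmap @` cdom, matter. *)
Record chart (R : realType) (n : nat) (Z : Type) := Chart {
  cdom : set Z;
  cmap : Z -> 'rV[R]_n;
  cinv : 'rV[R]_n -> Z }.

Definition cimg R n Z (c : @chart R n Z) := cmap c @` cdom c.

Definition is_chart R n (Z : topologicalType) (c : @chart R n Z) :=
  [/\ open (cdom c), open (cimg c),
      forall p, cdom c p -> cinv c (cmap c p) = p,
      forall p, cdom c p -> {for p, continuous (cmap c)} &
      forall x, cimg c x -> {for x, continuous (cinv c)}].

Definition smoothly_compatible R n (Z : topologicalType) (c c' : @chart R n Z) :=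
  forall i : 'I_n, smooth_on (cmap c @` (cdom c `&` cdom c'))
    (fun x => cmap c' (cinv c x) 0 i : R^o).

Record manifold (R : realType) (n : nat) := Manifold {
  points :> topologicalType;
  atlas : set (@chart R n points);
  atlas_chart : forall c, atlas c -> is_chart c;
  atlas_cover : forall p, exists2 c, atlas c & cdom c p;
  atlas_compatible : forall c c', atlas c -> atlas c' -> smoothly_compatible c c';
  manifold_hausdorff : hausdorff_space points;
  manifold_second_countable : @second_countable points;
  manifold_connected : connected [set: points] }.

Section SmoothFunctions.
Context {R : realType} {n : nat} (Z : manifold R n).

Definition is_smooth (f : Z -> R^o) :=
  forall c, atlas c -> smooth_on (cimg c) (f \o cinv c).

Definition smooth_pred : {pred Z -> R^o} := fun f => `[< is_smooth f >].

Lemma smooth_subring : subring_closed smooth_pred.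
Proof.
have sm f : f \in smooth_pred -> is_smooth f by move/asboolP.
split.
- by apply/asboolP => c _ k; exact: Ck_cst.
- move=> f g /sm sf /sm sg; apply/asboolP => c Ac k.
  have -> : (f - g) \o cinv c = -1 *: (g \o cinv c) + (f \o cinv c).
    by apply/funext => x; rewrite scaleN1r addrC.
  by apply: CkZD; [have [] := atlas_chart Ac|exact: sg|exact: sf].
- move=> f g /sm sf /sm sg; apply/asboolP => c Ac k.
  by apply: CkM; [have [] := atlas_chart Ac|exact: sf|exact: sg].
Qed.

Lemma smooth_submod : submod_closed smooth_pred.
Proof.
have [s1 sB _] := smooth_subring.
split=> [|a f g /asboolP sf /asboolP sg]; first by rewrite -(subrr 1) sB.
apply/asboolP => c Ac k.
by apply: CkZD; [have [] := atlas_chart Ac|exact: sf|exact: sg].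
Qed.

HB.instance Definition _ := GRing.isSubringClosed.Build _ smooth_pred smooth_subring.
HB.instance Definition _ := GRing.isSubmodClosed.Build _ _ smooth_pred smooth_submod.

Record smooth := Smooth { sval_ :> Z -> R^o; _ : sval_ \in smooth_pred }.

HB.instance Definition _ := [isSub for sval_].
HB.instance Definition _ := [Choice of smooth by <:].
HB.instance Definition _ :=
  GRing.SubChoice_isSubComPzRing.Build _ _ smooth (subringClosedP _).
HB.instance Definition _ := [SubZmodule_isSubLmodule of smooth by <:].

Lemma smoothDE (f g : smooth) p : (f + g) p = f p + g p. Proof. by []. Qed.
Lemma smoothNE (f : smooth) p : (- f) p = - f p. Proof. by []. Qed.
Lemma smoothME (f g : smooth) p : (f * g) p = f p * g p. Proof. by []. Qed.
Lemma smoothZE (a : R) (f : smooth) p : (a *: f) p = a * f p. Proof. by []. Qed.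
Definition smoothE := (smoothDE, smoothNE, smoothME, smoothZE).

End SmoothFunctions.

Section Alternating.
Context {R : realType}.

Definition upd (T : Type) r (x : 'I_r -> T) (i : 'I_r) (u : T) : 'I_r -> T :=
  fun j => if j == i then u else x j.

Definition fcons (T : Type) r (u : T) (x : 'I_r -> T) : 'I_r.+1 -> T :=
  fun j => oapp x u (unlift ord0 j).

Definition alternating_form (V : lmodType R) r (phi : ('I_r -> V) -> R) :=
  (forall x i (a : R) u v, phi (upd x i (a *: u + v)) =
                           a * phi (upd x i u) + phi (upd x i v)) /\
  (forall x i j, i != j -> x i = x j -> phi x = 0).

Context {n : nat} {Z : manifold R n}.

(* A smooth section phi of the bundle of alternating r-forms on the fibres V p,
   presented by its values on r-tuples from a family E of sections of V whose
   values span every fibre; val p e is the value at p of e. *)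
Definition is_section (V : Z -> lmodType R) (E : Type) (val : forall p, E -> V p)
    r (Phi : ('I_r -> E) -> smooth Z) :=
  forall p, exists2 phi : ('I_r -> V p) -> R, alternating_form phi &
    forall x, Phi x p = phi (fun i => val p (x i)).

Lemma alternating_formZD (V : lmodType R) r (a : R) (phi psi : ('I_r -> V) -> R) :
  alternating_form phi -> alternating_form psi ->
  alternating_form (fun x => a * phi x + psi x).
Proof.
move=> [lphi aphi] [lpsi apsi]; split=> [x i b u v|x i j ij xij].
  by rewrite lphi lpsi; ring.
by rewrite (aphi _ _ _ ij xij) (apsi _ _ _ ij xij) mulr0 addr0.
Qed.

Lemma is_section_submod V E val r :
  submod_closed (fun Phi => `[< @is_section V E val r Phi >]).
Proof.
split=> [|a Phi Psi /asboolP sPhi /asboolP sPsi]; apply/asboolP => p.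
  by exists (fun=> 0) => //; split=> *; rewrite ?mulr0 ?addr0.
have [phi aphi Ephi] := sPhi p; have [psi apsi Epsi] := sPsi p.
exists (fun x => a * phi x + psi x); first exact: alternating_formZD.
by move=> x; rewrite -Ephi -Epsi.
Qed.

End Alternating.

Section Tangent.
Context {R : realType} {n : nat} {Z : manifold R n}.
Implicit Types (p : Z) (f g : smooth Z).

Definition derivation_at p (v : smooth Z -> R^o) :=
  (forall (a : R) f g, v (a *: f + g) = a *: v f + v g) /\
  (forall f g, v (f * g) = f p * v g + g p * v f).

Definition tangent_pred p : {pred smooth Z -> R^o} :=
  fun v => `[< derivation_at p v >].

Lemma tangent_submod p : submod_closed (tangent_pred p).
Proof.
split=> [|a u v /asboolP[lu du] /asboolP[lv dv]]; apply/asboolP; split.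
- by move=> a f g; rewrite scaler0 addr0.
- by move=> f g; rewrite !mulr0 addr0.
- by move=> b f g; rewrite !fctE lu lv /GRing.scale /=; ring.
- by move=> f g; rewrite !fctE du dv /GRing.scale /=; ring.
Qed.

HB.instance Definition _ p :=
  GRing.isSubmodClosed.Build _ _ (tangent_pred p) (tangent_submod p).

Record tangent p := Tangent { tval :> smooth Z -> R^o; _ : tval \in tangent_pred p }.
HB.instance Definition _ p := [isSub for @tval p].
HB.instance Definition _ p := [Choice of tangent p by <:].
HB.instance Definition _ p := [SubChoice_isSubLmodule of tangent p by <:].


(* The cotangent space at p is the space of the differentials d_p f: v |-> v f. *)
Definition cotangent_pred p : {pred tangent p -> R^o} :=
  fun xi => `[< exists f, xi = fun v => v f >].

Lemma tangentZD p (v : tangent p) (a : R) f g : v (a *: f + g) = a *: v f + v g.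
Proof. by case/asboolP: (valP v) => + _; apply. Qed.

Lemma tangentM p (v : tangent p) f g : v (f * g) = f p * v g + g p * v f.
Proof. by case/asboolP: (valP v) => _; apply. Qed.

Lemma tangent0 p (v : tangent p) : v 0 = 0.
Proof. by rewrite -(addNr 0) -scaleN1r tangentZD scaleN1r addNr. Qed.

Lemma cotangent_submod p : submod_closed (@cotangent_pred p).
Proof.
split=> [|a _ _ /asboolP[f ->] /asboolP[g ->]]; apply/asboolP.
  by exists 0; apply/funext => v; rewrite tangent0.
by exists (a *: f + g); apply/funext => v; rewrite tangentZD.
Qed.

HB.instance Definition _ p :=
  GRing.isSubmodClosed.Build _ _ (@cotangent_pred p) (cotangent_submod p).

Record cotangent p :=
  Cotangent { ctval :> tangent p -> R^o; _ : ctval \in @cotangent_pred p }.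
HB.instance Definition _ p := [isSub for @ctval p].
HB.instance Definition _ p := [Choice of cotangent p by <:].
HB.instance Definition _ p := [SubChoice_isSubLmodule of cotangent p by <:].

Lemma differential_subproof p f : (fun v : tangent p => v f) \in @cotangent_pred p.
Proof. by apply/asboolP; exists f. Qed.

Definition differential p f : cotangent p := Cotangent (differential_subproof p f).

Record vector_field := VectorField {
  vf :> smooth Z -> smooth Z;
  vfP : forall p, derivation_at p (fun f => vf f p) }.

Definition at_point p (X : vector_field) : tangent p :=
  Tangent (asboolT (vfP X p) : _ \in tangent_pred p).

Lemma vfZD (X : vector_field) (a : R) f g : X (a *: f + g) = a *: X f + X g.
Proof. by apply/val_inj/funext => p; have [+ _] := vfP X p; apply. Qed.

Lemma vfD (X : vector_field) f g : X (f + g) = X f + X g.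
Proof. by rewrite -[f]scale1r vfZD !scale1r. Qed.

Lemma vfM (X : vector_field) f g : X (f * g) = f * X g + g * X f.
Proof. by apply/val_inj/funext => p; have [_ +] := vfP X p; apply. Qed.

Lemma lie_subproof (X Y : vector_field) p :
  derivation_at p (fun f => (X (Y f) - Y (X f)) p).
Proof.
split=> [a f g|f g].
  by rewrite !vfZD !smoothE /GRing.scale /=; ring.
by rewrite !vfM !vfD !vfM !smoothE; ring.
Qed.

Definition lie (X Y : vector_field) : vector_field :=
  @VectorField (fun f => X (Y f) - Y (X f)) (lie_subproof X Y).

Lemma differentialZD p (a : R) f g :
  differential p (a *: f + g) = a *: differential p f + differential p g.
Proof. by apply/val_inj/funext => v /=; rewrite tangentZD. Qed.

Lemma differentialM p f g :
  differential p (f * g) = f p *: differential p g + g p *: differential p f.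
Proof. by apply/val_inj/funext => v /=; rewrite tangentM. Qed.

End Tangent.
Arguments vector_field {R n} Z.

Section Multivector.
Context {R : realType} {n : nat} {Z : manifold R n}.
Implicit Types (p : Z) (f g h : smooth Z).

(* P (f_1, .., f_r) stands for P (df_1, .., df_r). *)
Local Notation multi r := (('I_r -> smooth Z) -> smooth Z).

Definition is_multivector r (P : multi r) :=
  is_section (V := fun p => cotangent p) differential P.

(* (P . Q) (df_1, .., df_m), m = r + s - 1, is the alternating sum of
   P (d (Q (df_(r), .., df_m)), df_1, .., df_(r-1)) over all (r-1, s)-shuffles,
   written as a sum over permutations. In coordinates, and up to second
   derivatives of the f_i which cancel in the bracket below, it is the r-fold
   contraction r / (r! s!) P^(mu l_2 .. l_r) d_mu Q^(a_1 .. a_s). *)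
Definition bullet r s : multi r -> multi s -> multi (r + s).-1 :=
  match r return multi r -> multi s -> multi (r + s).-1 with
  | 0 => fun _ _ _ => 0
  | r'.+1 => fun P Q x =>
      ((r'`! * s`!)%:R^-1 : R) *: \sum_(pi : 'S_(r' + s)) ((-1) ^+ pi : R) *:
        P (fcons (Q (fun j => x (pi (rshift r' j)))) (fun i => x (pi (lshift s i))))
  end.

(* [P, Q] = P . Q + (-1)^(r s) Q . P; in particular [w, f] = w#(df), and [X, Y] is
   the Lie bracket for r = s = 1. *)
Definition schouten r s (P : multi r) (Q : multi s) : multi (r + s).-1 :=
  fun x => bullet P Q x + ((-1) ^+ (r * s) : R) *:
    bullet Q P (x \o cast_ord (congr1 predn (addnC s r))).

Record bivector := Bivector {
  bv :> ('I_2 -> smooth Z) -> smooth Z;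
  bvP : is_multivector bv }.

Definition poisson (w : bivector) := schouten w w = 0.

Implicit Type w : bivector.

Lemma bivectorZDl w (a : R) f g (h : 'I_1 -> smooth Z) :
  w (fcons (a *: f + g) h) = a *: w (fcons f h) + w (fcons g h).
Proof.
apply/val_inj/funext => p; have [phi [lphi _] E] := bvP w p.
have D u : (fun i => differential p (fcons u h i)) =
    upd (fun=> differential p (h ord0)) ord0 (differential p u).
  by apply/funext => i; case: (unliftP ord0 i) => [j|] ->;
     rewrite /fcons /upd ?unlift_none ?liftK //= (ord1 j).
have W u : w (fcons u h) p = phi (upd (fun=> differential p (h ord0)) ord0 (differential p u)).
  by rewrite E D.
by rewrite -[LHS]/(w _ p) W differentialZD lphi -!W.
Qed.

Lemma bivector_derivation w f p :
  derivation_at p (fun g => w (fcons f (fun=> g)) p).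
Proof.
have [phi [lphi _] E] := bvP w p.
have W u : w (fcons f (fun=> u)) p =
    phi (upd (fun=> differential p f) ord_max (differential p u)).
  rewrite E; congr phi; apply/funext => i.
  case: (unliftP ord0 i) => [j|] ->; rewrite /fcons /upd ?unlift_none ?liftK //=.
  by rewrite (ord1 j).
split=> [a g h|g h]; rewrite !W ?differentialZD ?differentialM ?lphi //.
set x := (fun=> _); set u := differential p g.
have phi0 : phi (upd x ord_max 0) = 0.
  by have := lphi x ord_max (-1) 0 0; rewrite scaler0 addr0 mulN1r addNr.
by have := lphi x ord_max (h p) u 0; rewrite addr0 phi0 addr0 => ->.
Qed.

(* The vector field w#(df) : g |-> w (df, dg). *)
Definition hamiltonian w f : vector_field Z :=
  @VectorField _ _ Z (fun g => w (fcons f (fun=> g))) (bivector_derivation w f).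


Definition potential p (xi : cotangent p) : smooth Z :=
  projT1 (cid (asboolW (valP xi))).

Lemma potentialK p (xi : cotangent p) : differential p (potential xi) = xi.
Proof. by apply/val_inj => /=; rewrite /potential; case: cid => f /= ->. Qed.

(* w#_p : T*_pZ -> T_pZ, that is d_p g (w#_p xi) = w_p (xi, d_p g). *)
Definition sharp_at w p (xi : cotangent p) : tangent p :=
  at_point p (hamiltonian w (potential xi)).

Lemma sharp_at_inj w p f g : differential p f = differential p g ->
  at_point p (hamiltonian w f) = at_point p (hamiltonian w g).
Proof.
move=> fg; apply/val_inj/funext => h /=; have [phi _ E] := bvP w p.
rewrite !E; congr phi; apply/funext => i.
by case: (unliftP ord0 i) => [j|] ->; rewrite /fcons ?unlift_none ?liftK.
Qed.

Lemma sharp_atE w p f : sharp_at w (differential p f) = at_point p (hamiltonian w f).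
Proof. by apply: sharp_at_inj; rewrite potentialK. Qed.

Lemma sharp_atZD w p (a : R) (xi eta : cotangent p) :
  sharp_at w (a *: xi + eta) = a *: sharp_at w xi + sharp_at w eta.
Proof.
rewrite -[xi]potentialK -[eta]potentialK -differentialZD !sharp_atE.
by apply/val_inj/funext => h; rewrite /= bivectorZDl.
Qed.

Definition char_pred w p : {pred tangent p} := fun v => `[< exists xi, v = sharp_at w xi >].
Arguments char_pred : clear implicits.

Lemma char_submod w p : submod_closed (char_pred w p).
Proof.
split=> [|a _ _ /asboolP[xi ->] /asboolP[eta ->]]; apply/asboolP.
  by exists 0; have := sharp_atZD w (-1) (0 : cotangent p) 0;
     rewrite scaler0 addr0 scaleN1r addNr.
by exists (a *: xi + eta); rewrite sharp_atZD.
Qed.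

HB.instance Definition _ w p :=
  GRing.isSubmodClosed.Build _ _ (char_pred w p) (char_submod w p).

(* The fibre T_pF = w#_p (T*_pZ) of the tangent bundle TF of the
   characteristic foliation. *)
Record char_tangent w p :=
  CharTangent { chval :> tangent p; _ : chval \in char_pred w p }.
HB.instance Definition _ w p := [isSub for @chval w p].
HB.instance Definition _ w p := [Choice of char_tangent w p by <:].
HB.instance Definition _ w p := [SubChoice_isSubLmodule of char_tangent w p by <:].

Definition has_dimension (V : lmodType R) (k : nat) :=
  exists e : 'I_k -> V, forall v, exists! c : 'I_k -> R, v = \sum_i c i *: e i.

Definition regular w := exists k, forall p, has_dimension (char_tangent w p) k.

(* A global section of TF. *)
Record char_field w := CharField {
  chf :> vector_field Z;
  chfP : forall p, at_point p chf \in char_pred w p }.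

Definition char_at_point w p (X : char_field w) : char_tangent w p :=
  CharTangent (chfP X p).

(* TF is involutive when w is a regular Poisson structure, so that the default
   value X is then never used. *)
Definition char_lie w (X Y : char_field w) : char_field w :=
  if pselect (forall p, at_point p (lie X Y) \in char_pred w p) is left XY
  then CharField XY else X.

End Multivector.
Arguments bivector {R n} Z.

(* A complex base -> C^0 -> C^1 -> .., where base and C^r are contained in ambient
   modules on which the differential is given by a formula. *)
Record complex (R : pzRingType) := Complex {
  ambient : nat -> lmodType R;
  cochain : forall r, {pred ambient r};
  cochain_submod : forall r, submod_closed (@cochain r);
  base : {pred ambient 0};
  diff : forall r, ambient r -> ambient r.+1;
  diff_linear : forall r, linear (@diff r) }.
Arguments diff {R} _ {r}.
Arguments cochain {R} _ r.
Arguments base {R} _.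

Section Cohomology.
Context {R : pzRingType}.
Implicit Types C D : complex R.

Definition cocycle_pred C r : {pred ambient C r} :=
  fun x => (x \in cochain C r) && (diff C x == 0).

Lemma cocycle_submod C r : submod_closed (@cocycle_pred C r).
Proof.
have [c0 cZD] := cochain_submod C r.
have d0 : diff C (0 : ambient C r) = 0.
  have := @diff_linear _ C r (-1) 0 0.
  by rewrite scaler0 addr0 scaleN1r addNr.
split=> [|a x y /andP[cx /eqP dx] /andP[cy /eqP dy]]; apply/andP; split => //.
- exact/eqP.
- exact: cZD.
- by rewrite diff_linear dx dy scaler0 addr0.
Qed.

HB.instance Definition _ C r :=
  GRing.isSubmodClosed.Build _ _ (@cocycle_pred C r) (cocycle_submod C r).

Record cocycle C r := Cocycle { cyval :> ambient C r; _ : cyval \in @cocycle_pred C r }.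
HB.instance Definition _ C r := [isSub for @cyval C r].
HB.instance Definition _ C r := [Choice of cocycle C r by <:].
HB.instance Definition _ C r := [SubChoice_isSubLmodule of cocycle C r by <:].

Definition is_coboundary C r : ambient C r -> Prop :=
  match r with
  | 0 => fun x => x = 0
  | r'.+1 => fun x => exists2 y, y \in cochain C r' & x = diff C y
  end.

Definition coboundary_pred C r : {pred cocycle C r} :=
  fun x => `[< is_coboundary (x : ambient C r) >].

Lemma coboundary_submod C r : submod_closed (@coboundary_pred C r).
Proof.
have d0 s : diff C (0 : ambient C s) = 0.
  have := @diff_linear _ C s (-1) 0 0.
  by rewrite scaler0 addr0 scaleN1r addNr.
case: r => [|r]; split=> [|a x y /asboolP bx /asboolP b_y]; apply/asboolP => //=.
- by rewrite /= in bx b_y *; rewrite bx b_y scaler0 addr0.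
- by exists 0; [have [] := cochain_submod C r|rewrite d0].
- case: bx b_y => [u cu Eu] [v cv Ev]; exists (a *: u + v).
    by have [_] := cochain_submod C r; apply.
  by rewrite diff_linear -Eu -Ev.
Qed.

HB.instance Definition _ C r :=
  GRing.isSubmodClosed.Build _ _ (@coboundary_pred C r) (coboundary_submod C r).

(* Z^r / B^r; the coboundary predicate is a submodule of the module of cocycles. *)
Definition cohomology C r : Type := Quotient.quot (@coboundary_pred C r).

HB.instance Definition _ C r := GRing.Zmodule.on (cohomology C r).

Definition cohomology_class C r (x : cocycle C r) : cohomology C r :=
  (\pi_(Quotient.quot (@coboundary_pred C r)) x)%qT.

Definition cohomology_scale C r (a : R) (h : cohomology C r) : cohomology C r :=
  cohomology_class (a *: repr h).

Lemma class_scale C r a (x : cocycle C r) :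
  cohomology_scale a (cohomology_class x) = cohomology_class (a *: x).
Proof.
apply/eqP; rewrite -Quotient.idealrBE -scalerBr rpredZ //.
by rewrite Quotient.idealrBE reprK.
Qed.

Lemma class_add C r (x y : cocycle C r) :
  cohomology_class (x + y) = cohomology_class x + cohomology_class y.
Proof. by rewrite /cohomology_class piE. Qed.

Lemma class_repr C r (h : cohomology C r) : cohomology_class (repr h) = h.
Proof. exact: reprK. Qed.

Lemma cohomology_scaleA C r a b (h : cohomology C r) :
  cohomology_scale a (cohomology_scale b h) = cohomology_scale (a * b) h.
Proof. by rewrite -[h]class_repr !class_scale scalerA. Qed.

Lemma cohomology_scale1 C r : left_id 1 (@cohomology_scale C r).
Proof. by move=> h; rewrite -[h]class_repr class_scale scale1r. Qed.

Lemma cohomology_scaleDr C r : right_distributive (@cohomology_scale C r) +%R.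
Proof.
move=> a g h; rewrite -[g]class_repr -[h]class_repr.
by rewrite -class_add !class_scale scalerDr class_add.
Qed.

Lemma cohomology_scaleDl C r (h : cohomology C r) :
  {morph (@cohomology_scale C r)^~ h : a b / a + b}.
Proof. by move=> a b; rewrite -[h]class_repr !class_scale scalerDl class_add. Qed.

HB.instance Definition _ C r :=
  GRing.Zmodule_isLmodule.Build R (cohomology C r) (@cohomology_scaleA C r)
    (@cohomology_scale1 C r) (@cohomology_scaleDr C r) (@cohomology_scaleDl C r).

(* A morphism C -> D of augmented complexes. *)
Definition cochain_morphism C D (f : forall r, ambient C r -> ambient D r) :=
  [/\ forall r, linear (f r),
      forall r x, x \in cochain C r -> f r x \in cochain D r,
      forall r x, x \in cochain C r -> f r.+1 (diff C x) = diff D (f r x) &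
      forall x, x \in base C -> f 0 x \in base D].

(* F is the homomorphism [f] : H^r(C) -> H^r(D), [x] |-> [f x]. *)
Definition induced_by C D (f : forall r, ambient C r -> ambient D r) r
    (F : cohomology C r -> cohomology D r) :=
  linear F /\ forall x : cocycle C r, exists2 y : cocycle D r,
    f r x = y & F (cohomology_class x) = cohomology_class y.

End Cohomology.

(* In the three complexes below the cochain spaces vanish above the rank of the
   bundle, by alternation, so no bound on the degree is imposed. *)

Section Complexes.
Context {R : realType} {n : nat} (Z : manifold R n).

Local Notation multi E r := (('I_r -> E) -> smooth Z).

(* The Chevalley-Eilenberg differential of a Lie algebra E of vector fields;
   phi ([X_i, X_j], .., ^X_i, .., ^X_j, ..) appears with the bracket moved to the
   i-th place, which absorbs the factor (-1)^i of the usual sign (-1)^(i+j). *)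
Definition chevalley_eilenberg (E : Type) (act : E -> vector_field Z)
    (br : E -> E -> E) r (phi : multi E r) : multi E r.+1 :=
  fun X =>
    \sum_(i < r.+1) ((-1) ^+ i : R) *: act (X i) (phi (fun k => X (lift i k))) +
    \sum_(j < r.+1) \sum_(i < r.+1 | (i < j)%N) ((-1) ^+ j : R) *:
      phi (fun k => if lift j k == i then br (X i) (X j) else X (lift j k)).

Lemma chevalley_eilenberg_linear E act br r : linear (@chevalley_eilenberg E act br r).
Proof.
move=> a phi psi; apply/funext => X; rewrite /chevalley_eilenberg !fctE.
rewrite scalerDr [RHS]addrACA !scaler_sumr.
congr (_ + _); rewrite -big_split /=.
  apply: eq_bigr => i _; rewrite vfZD scalerDr !scalerA.
  by rewrite [_ * a]mulrC.
apply: eq_bigr => j _; rewrite scaler_sumr -big_split /=.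
by apply: eq_bigr => i _; rewrite scalerDr !scalerA [_ * a]mulrC.
Qed.

Definition de_rham : complex R := {|
  ambient r := multi (vector_field Z) r;
  cochain r := fun phi => `[< is_section (V := fun p => tangent p) at_point phi >];
  cochain_submod r := is_section_submod _ _;
  base := fun phi => `[< exists c : R, phi = fun=> c *: (1 : smooth Z) >];
  diff := chevalley_eilenberg id lie;
  diff_linear := chevalley_eilenberg_linear id lie |}.

Variable w : bivector Z.

(* S_F(Z) as the centre of the Poisson algebra, {f, g} = w (df, dg). *)
Definition casimir (f : smooth Z) := forall g, w (fcons f (fun=> g)) = 0.

Definition leafwise : complex R := {|
  ambient r := multi (char_field w) r;
  cochain r := fun phi => `[< is_section (V := fun p => char_tangent w p)
                                (@char_at_point _ _ _ w) phi >];
  cochain_submod r := is_section_submod _ _;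
  base := fun phi => `[< forall X, casimir (phi X) >];
  diff := chevalley_eilenberg (@chf _ _ _ w) (@char_lie _ _ _ w);
  diff_linear := chevalley_eilenberg_linear (@chf _ _ _ w) (@char_lie _ _ _ w) |}.

Definition lp_diff r (theta : multi (smooth Z) r) : multi (smooth Z) r.+1 :=
  - schouten w theta.

Lemma opp_lp_linear r : linear (fun theta => - @lp_diff r theta).
Proof.
have bw a (P Q : multi (smooth Z) r) x :
    bullet w (a *: P + Q) x = a *: bullet w P x + bullet w Q x.
  rewrite /bullet scalerA [a * _]mulrC -scalerA -scalerDr; congr (_ *: _).
  rewrite scaler_sumr -big_split /=; apply: eq_bigr => s _.
  by rewrite !fctE bivectorZDl scalerDr !scalerA [_ * a]mulrC.
have wb a (P Q : multi (smooth Z) r) x :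
    bullet (a *: P + Q) w x = a *: bullet P w x + bullet Q w x.
  clear bw; case: r P Q x => [|s] P Q x; first by rewrite /bullet scaler0 addr0.
  rewrite /bullet scalerA [a * _]mulrC -scalerA -scalerDr; congr (_ *: _).
  rewrite scaler_sumr -big_split /=; apply: eq_bigr => t _.
  by rewrite !fctE scalerDr !scalerA [_ * a]mulrC.
move=> a P Q; rewrite /lp_diff !opprK; apply/funext => x.
rewrite !fctE /schouten bw wb !scalerDr !scalerA [_ * a]mulrC.
exact: addrACA.
Qed.

(* The differential is -^w, with ^w (theta) = - [w, theta] = lp_diff theta; it has
   the same cocycles and coboundaries as ^w. *)
Definition lichnerowicz_poisson : complex R := {|
  ambient r := multi (smooth Z) r;
  cochain r := fun theta => `[< is_multivector theta >];
  cochain_submod r := is_section_submod _ _;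
  base := fun theta => `[< forall x, casimir (theta x) >];
  diff r := fun theta => - @lp_diff r theta;
  diff_linear := opp_lp_linear |}.

(* i_F^* *)
Definition restriction r (phi : ambient de_rham r) : ambient leafwise r :=
  fun X => phi (fun i => chf (X i)).

(* w#(phi) (s_1, .., s_r) = (-1)^r phi (w#(s_1), .., w#(s_r)) for s_i = df_i;
   sharpE gives the same formula on arbitrary covectors at a point. *)
Definition sharp r (phi : ambient de_rham r) : ambient lichnerowicz_poisson r :=
  fun f => ((-1) ^+ r : R) *: phi (fun i => hamiltonian w (f i)).

Lemma sharpE r (phi : ambient de_rham r) p (phip : ('I_r -> tangent p) -> R) :
  (forall X, phi X p = phip (fun i => at_point p (X i))) ->
  forall f, sharp phi f p =
    (-1) ^+ r * phip (fun i => sharp_at w (differential p (f i))).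
Proof.
move=> Ephi f; rewrite /sharp smoothZE Ephi; congr (_ * phip _).
by apply/funext => i; rewrite sharp_atE.
Qed.

End Complexes.
Arguments restriction {R n Z} w r phi _ : rename.
Arguments sharp {R n Z} w r phi _ : rename.

(* Main.v *)
(* The map g theta (df_1, .., df_r) = (-1)^r theta (X_(f_1), .., X_(f_r)), where X_f is
   the Hamiltonian field of f, is defined on leafwise forms because X_f is tangent to
   the leaves, and w# = g o i_F^* by construction. On the differentials df_i the
   Schouten bracket [w, P] becomes the Chevalley-Eilenberg formula for the Poisson
   bracket, and the Jacobi identity [X_f, X_g] = X_{f, g} matches it with the leafwise
   differential. That i_F^* is a cochain morphism requires TF to be involutive: since
   w has constant rank, every section of TF, multiplied by a function not vanishing
   at a given point, is a combination of Hamiltonian fields with smooth coefficients. *)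
Require Import Defs.
From HB Require Import structures.
From mathcomp Require Import all_boot all_order perm all_algebra.
From mathcomp Require Import generic_quotient ring_quotient ring.
From mathcomp Require Import boolp classical_sets functions reals topology.

Set Implicit Arguments.
Unset Strict Implicit.
Unset Printing Implicit Defensive.

Import GRing.Theory Num.Theory.

Local Open Scope ring_scope.

(** * Sums over permutations and sections of alternating bundles *)

Lemma sum_lift_perm (V : nmodType) n (i0 : 'I_n.+1) (F : 'S_n.+1 -> V) :
  \sum_s F s = \sum_j \sum_(t : 'S_n) F (lift_perm i0 j t).
Proof.
rewrite pair_bigA /= (reindex (fun u => lift_perm i0 u.1 u.2)) //.
(* Both index sets have (n+1)! elements, so injectivity is enough. *)
apply/onW_bij/inj_card_bij; last first.
  by rewrite card_prod card_ord !card_Sn.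
move=> [j s] [k t] /= /permP st.
have jk : j = k by rewrite -(lift_perm_id i0 j s) st lift_perm_id.
congr pair => //; apply/permP => a; have := st (lift i0 a).
by rewrite !lift_perm_lift jk => /lift_inj.
Qed.

Section AlternatingForms.
Context {R : realType}.

(** Polarization: [phi] vanishes when the sum of [x i] and [x j] fills both places, and the diagonal
    terms of the expansion vanish too, so the two mixed terms cancel. *)
Lemma alternating_tperm (V : lmodType R) r (phi : ('I_r -> V) -> R) x i j :
  alternating_form phi -> i != j -> phi (x \o tperm i j) = - phi x.
Proof.
move=> [lphi aphi] ij; pose A u v := upd (upd x i u) j v.
have AE u v : A u v = upd (upd x j v) i u.
  apply/funext => k; rewrite /A /upd.
  by case: eqVneq => // ->; rewrite eq_sym (negPf ij).
have A0 u : phi (A u u) = 0.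
  by apply: (aphi _ i j) => //; rewrite /A /upd !eqxx (negPf ij).
have AD u v : phi (A u v) + phi (A v u) = 0.
  have := A0 (1 *: u + v); rewrite AE lphi -!AE {1 2}/A !lphi -!/(A _ _).
  by rewrite !A0 !mul1r addr0 add0r.
have -> : x \o tperm i j = A (x j) (x i).
  apply/funext => k; rewrite /A /upd /=;
  case: tpermP => [->|->|/eqP/negPf -> /eqP/negPf ->] //.
    by rewrite (negPf ij) eqxx.
  by rewrite eqxx.
have xE : A (x i) (x j) = x.
  by apply/funext => k; rewrite /A /upd; case: eqVneq => [->//|_]; case: eqVneq => [->|].
by apply/eqP; rewrite -[X in - phi X]xE -addr_eq0 AD.
Qed.

Lemma alternating_perm (V : lmodType R) r (phi : ('I_r -> V) -> R) x (s : 'S_r) :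
  alternating_form phi -> phi (x \o s) = (-1) ^+ s * phi x.
Proof.
move=> aphi; have [ts -> dts] := prod_tpermP s.
elim: ts dts x => [_|[i j] ts IH /= /andP[ij /IH{}IH]] x.
  rewrite big_nil odd_perm1 mul1r; congr phi.
  by apply/funext => k; rewrite /= perm1.
rewrite big_cons odd_permM odd_tperm ij /=.
set s' := (\prod_(t <- ts) _)%g in IH *.
have -> : x \o (tperm i j * s')%g = (x \o s') \o tperm i j.
  by apply/funext => k; rewrite /= permM.
by rewrite (alternating_tperm _ aphi ij) IH signrN mulNr.
Qed.

Context {n : nat} {Z : manifold R n}.
Variables (V : Z -> lmodType R) (E : Type) (val : forall p, E -> V p).

Lemma section_perm r (Phi : ('I_r -> E) -> smooth Z) x (s : 'S_r) :
  is_section val Phi -> Phi (x \o s) = ((-1) ^+ s : R) *: Phi x.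
Proof.
move=> sPhi; apply/val_inj/funext => p; have [phi aphi E_] := sPhi p.
rewrite -[LHS]/(Phi _ p) -[RHS]/((_ *: Phi x) p) smoothZE !E_.
exact: (alternating_perm (fun i => val p (x i))).
Qed.

Lemma section_local r (Phi : ('I_r -> E) -> smooth Z) x y p :
  is_section val Phi -> (forall i, val p (x i) = val p (y i)) ->
  Phi x p = Phi y p.
Proof.
by move=> /(_ p)[phi _ E_] xy; rewrite !E_; congr phi; apply/funext.
Qed.

Lemma section_fcons_perm r (Phi : ('I_r.+1 -> E) -> smooth Z) u x (s : 'S_r) :
  is_section val Phi -> Phi (fcons u (x \o s)) = ((-1) ^+ s : R) *: Phi (fcons u x).
Proof.
move=> /(section_perm (fcons u x) (lift_perm ord0 ord0 s)).
rewrite odd_lift_perm addbb => <-; congr Phi.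
apply/funext => k /=; case: (unliftP ord0 k) => [k'|] ->; rewrite /fcons.
  by rewrite lift_perm_lift !liftK.
by rewrite lift_perm_id !unlift_none.
Qed.

(** The cycle [lift_perm ord0 i 1] carries place [i] to the front past [i] others, whence the
    sign. *)
Lemma section_front r (Phi : ('I_r.+1 -> E) -> smooth Z) (x : 'I_r.+1 -> E) i u :
  is_section val Phi ->
  Phi (fcons u (x \o lift i)) = ((-1) ^+ i : R) *: Phi (upd x i u).
Proof.
move=> /(section_perm (upd x i u) (lift_perm ord0 i 1)).
rewrite odd_lift_perm odd_perm1 addbF signr_odd => <-; congr Phi.
apply/funext => k /=; case: (unliftP ord0 k) => [k'|] ->; rewrite /fcons /upd.
  by rewrite liftK lift_perm_lift perm1 eq_sym (negPf (neq_lift i k')).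
by rewrite unlift_none lift_perm_id eqxx.
Qed.

End AlternatingForms.

(** * The Schouten bracket with w on differentials, and the Jacobi identity *)

Section PoissonBracket.
Context {R : realType} {n : nat} {Z : manifold R n}.
Implicit Types (X Y : vector_field Z) (f g h : smooth Z).

Lemma vf0 X : X 0 = 0.
Proof. by apply: (addIr (X 0)); rewrite -vfD !add0r. Qed.

Lemma vfZ X (a : R) f : X (a *: f) = a *: X f.
Proof. by rewrite -[a *: f]addr0 vfZD vf0 addr0. Qed.

Lemma vf_sum X I (r : seq I) (P : pred I) (F : I -> smooth Z) :
  X (\sum_(i <- r | P i) F i) = \sum_(i <- r | P i) X (F i).
Proof. by elim/big_rec2: _ => [|i y1 y2 _ <-]; rewrite ?vf0 ?vfD. Qed.

Variable w : bivector Z.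

Lemma bivectorE (x : 'I_2 -> smooth Z) : w x = hamiltonian w (x ord0) (x ord_max).
Proof.
congr (bv w _); apply/funext => i; rewrite /fcons.
case: (unliftP ord0 i) => [j|] -> //=; congr x.
by apply/val_inj; rewrite (ord1 j).
Qed.

Lemma hamiltonianC f g : hamiltonian w f g = - hamiltonian w g f.
Proof.
have := section_perm (fcons g (fun=> f)) (tperm ord0 ord_max) (@bvP _ _ _ w).
rewrite odd_tperm /= expr1 scaleN1r => <-; congr (bv w _).
apply/funext => i; rewrite /fcons /=.
case: (unliftP ord0 i) => [j|] ->.
  have -> : lift ord0 j = ord_max :> 'I_2 by apply/val_inj; rewrite (ord1 j).
  by rewrite tpermR unlift_none.
rewrite tpermL; have -> : ord_max = lift ord0 ord0 :> 'I_2 by exact/val_inj.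
by rewrite liftK.
Qed.

Lemma hamiltonianZl (a : R) f g : hamiltonian w (a *: f) g = a *: hamiltonian w f g.
Proof. by rewrite hamiltonianC vfZ -scalerN -hamiltonianC. Qed.

Lemma multivector_fconsZ r (P : ('I_r.+1 -> smooth Z) -> smooth Z) (a : R) f x :
  is_multivector P -> P (fcons (a *: f) x) = a *: P (fcons f x).
Proof.
move=> mP; apply/val_inj/funext => p; have [phi [lphi _] E_] := mP p.
pose d xi := upd (fun k => differential p (fcons 0 x k)) ord0 xi.
have D g : (fun k => differential p (fcons g x k)) = d (differential p g).
  apply/funext => k; rewrite /d /upd /fcons.
  by case: (unliftP ord0 k) => [j|] ->; rewrite ?unlift_none ?liftK ?eqxx.
have phi0 : phi (d 0) = 0.
  have := lphi (fun k => differential p (fcons 0 x k)) ord0 (-1) 0 0.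
  by rewrite scaler0 addr0 mulN1r addNr.
rewrite -[LHS]/(P _ p) -[RHS]/((_ *: P _) p) smoothZE !E_ !D.
have d0 : differential p (0 : smooth Z) = 0.
  by apply/val_inj/funext => v /=; rewrite tangent0.
by rewrite -[a *: f]addr0 differentialZD d0 lphi -!/(d _) phi0 addr0.
Qed.

(** Permutations are grouped by the index [j] placed in the first slot of [w]. By alternation of
    [P], the [r!] permutations of a group give equal terms, which cancels the factor [1 / (1! r!)];
    antisymmetry is not applied to [w] itself here. *)
Lemma bullet_bivector r (P : ('I_r -> smooth Z) -> smooth Z) (x : 'I_r.+1 -> smooth Z) :
  is_multivector P ->
  bullet w P x = \sum_(i < r.+1) ((-1) ^+ i : R) *: hamiltonian w (P (x \o lift i)) (x i).
Proof.
move=> mP; rewrite /bullet (sum_lift_perm ord0) scaler_sumr; apply: eq_bigr => j _.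
set c := (X in _ = X).
rewrite (eq_bigr (fun=> c)) => [|t _].
  rewrite sumr_const card_Sn -scaler_nat scalerA mul1n mulVf ?scale1r //.
  by rewrite pnatr_eq0 -lt0n fact_gt0.
have -> : (fun k => x (lift_perm ord0 j t (rshift 1 k))) = (x \o lift j) \o t.
  apply/funext => k; rewrite /= -(lift_perm_lift ord0); congr (x (lift_perm _ _ _ _)).
  exact/val_inj.
rewrite (section_perm _ _ mP) bivectorE.
rewrite (_ : ord_max = lift ord0 ord0); last exact/val_inj.
rewrite /fcons unlift_none liftK hamiltonianZl scalerA.
rewrite [oapp _ _ _]/=.
have -> : lshift r (ord0 : 'I_1) = ord0 by exact/val_inj.
rewrite lift_perm_id odd_lift_perm /c /=; congr (_ *: _).
by rewrite signr_addb -mulrA -signr_addb addbb mulr1 signr_odd.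
Qed.

(** The two indices sent to [w] are fixed as [i < j]: antisymmetry of [w] accounts for the factor
    [2!], and the [r!] orders of the remaining arguments of [P] agree by alternation. In degree 0
    both sides vanish. *)
Lemma bivector_bullet r (P : ('I_r -> smooth Z) -> smooth Z) (x : 'I_r.+1 -> smooth Z)
    (e : (r + 2).-1 = r.+1) :
  is_multivector P ->
  bullet P w (x \o cast_ord e) =
  - \sum_(j < r.+1) \sum_(i < r.+1 | (i < j)%N) ((-1) ^+ j : R) *:
      P (fun k => if lift j k == i then hamiltonian w (x i) (x j) else x (lift j k)).
Proof.
case: r P x e => [|r] P x e mP.
  by rewrite big_ord1 big_pred0 ?oppr0.
pose T m (y : 'I_m -> smooth Z) a0 a1 (b : 'I_r -> 'I_m) :=
  \sum_(s : 'S_m) ((-1) ^+ s : R) *: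
    P (fcons (hamiltonian w (y (s a0)) (y (s a1))) (y \o s \o b)).
pose F a0 a1 (b : 'I_r -> 'I_r.+2) (s : 'S_r.+2) := ((-1) ^+ s : R) *:
    P (fcons (hamiltonian w (x (s a0)) (x (s a1))) (x \o s \o b)).
(* [a0] and [a1] are the places r and r+1, whose arguments enter [w]; [b] lists the first r places.
   Writing them through [lift ord_max] lets [lift_perm] evaluate on them. *)
pose a1 : 'I_r.+2 := ord_max.
pose a0 : 'I_r.+2 := lift ord_max (ord_max : 'I_r.+1).
pose b (i : 'I_r) : 'I_r.+2 := lift ord_max (lift (ord_max : 'I_r.+1) i).
have -> : bullet P w (x \o cast_ord e) =
    ((r`! * 2`!)%:R^-1 : R) *: \sum_s F a0 a1 b s.
  rewrite /bullet; congr (_ *: _).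
  (* The sum in [bullet] runs over ['S_(r + 2)]; with a variable [m] in its place the cast can be
     eliminated by substitution. *)
  have TE m (E : m = r.+2) (c0 c1 : 'I_m) (d : 'I_r -> 'I_m) :
      c0 = r :> nat -> c1 = r.+1 :> nat -> (forall i, d i = i :> nat) ->
      T m (x \o cast_ord E) c0 c1 d = \sum_s F a0 a1 b s.
    subst m => E0 E1 Ed.
    have -> : c0 = a0 by apply/val_inj; rewrite /= E0 /bump ltnn.
    have -> : c1 = a1 by apply/val_inj; rewrite /= E1.
    have -> : d = b.
      apply/funext => i; apply/val_inj; rewrite /= Ed /bump.
      rewrite (leqNgt r i) ltn_ord add0n.
      by rewrite (leqNgt r.+1 i) ltnS ltnW ?ltn_ord.
    have xE (q : r.+2 = r.+2) : x \o cast_ord q = x.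
      by apply/funext => i; rewrite /= cast_ord_id.
    by rewrite xE.
  rewrite -(TE _ e (rshift r ord0) (rshift r ord_max) (lshift 2)) //.
  - by apply: eq_bigr => s _; rewrite bivectorE.
  - by rewrite /= addn0.
  - by rewrite /= addn1.
(* Exchanging the last two places preserves every summand, so the permutations s
   with s a0 < s a1 contribute half of the sum. *)
pose t := tperm a0 a1.
have a01 : a0 != a1 by rewrite eq_sym neq_lift.
have Ft s : F a0 a1 b (t * s)%g = F a0 a1 b s.
  have -> : F a0 a1 b (t * s)%g = ((-1) ^+ (~~ s) : R) *:
      P (fcons (hamiltonian w (x (s a1)) (x (s a0))) (x \o s \o b)).
    rewrite /F odd_permM odd_tperm a01 !permM tpermL tpermR; congr (_ *: P (fcons _ _)).
    apply/funext => i; rewrite /= permM tpermD // /a0 /b ?neq_lift //.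
    by rewrite (inj_eq lift_inj) neq_lift.
  by rewrite hamiltonianC signrN -scaleN1r multivector_fconsZ //
    scaleN1r scaleNr scalerN opprK.
have -> : \sum_s F a0 a1 b s = (\sum_(s : 'S_r.+2 | (s a0 < s a1)%N) F a0 a1 b s) *+ 2.
  rewrite (bigID (fun s : 'S_r.+2 => (s a0 < s a1)%N)) /= mulr2n; congr (_ + _).
  rewrite (reindex_inj (mulgI t)) /=; apply: eq_big => s; last by rewrite Ft.
  rewrite !permM tpermL tpermR -leqNgt leq_eqVlt.
  by rewrite (inj_eq val_inj) (inj_eq perm_inj) (negPf a01).
rewrite big_mkcond (sum_lift_perm ord_max) -sumrN -sumrMnl scaler_sumr.
apply: eq_bigr => j _; rewrite (sum_lift_perm ord_max) /=.
(* The index [i = j] contributes nothing; the others are the [lift j i], matching the values of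
   [s a0] on the left. *)
rewrite [in RHS]big_mkcond (bigD1_ord j) //= ltnn add0r -sumrN -sumrMnl scaler_sumr.
apply: eq_bigr => i _.
pose B := hamiltonian w (x (lift j i)) (x j).
set c := (X in _ = - X).
rewrite (eq_bigr (fun=> - c)) => [|u _]; last first.
  have -> : lift_perm ord_max j (lift_perm ord_max i u) a0 = lift j i.
    by rewrite lift_perm_lift lift_perm_id.
  rewrite lift_perm_id /c -[nat_of_ord (lift j i)]/(bump j i).
  case: ifP => _; last by rewrite oppr0.
  rewrite /F lift_perm_lift !lift_perm_id.
  have -> : (x \o lift_perm ord_max j (lift_perm ord_max i u)) \o b =
      (x \o lift j \o lift i) \o u.
    by apply/funext => k; rewrite /= !lift_perm_lift.
  rewrite (section_fcons_perm _ _ _ mP) (section_front _ _ _ mP) !scalerA -scaleNr.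
  congr (_ *: P _); last first.
    apply/funext => k; rewrite /upd (inj_eq lift_inj).
    by case: eqP.
  (* The two uses of [ord_max], in consecutive sizes, have opposite parities and leave one minus
     sign. The signs of [i] and [u] each occur twice and cancel, so only that of [j] remains. *)
  rewrite !odd_lift_perm -(signr_odd _ i) -(signr_odd _ j) -signrN -!signr_addb /=.
  by congr (_ ^+ nat_of_bool _); case: (odd r) (odd i) (odd j) (odd_perm u) => [] [] [] [].
rewrite sumr_const card_Sn -mulrnA -scaler_nat scalerA mulVf ?scale1r //.
by rewrite pnatr_eq0 -lt0n muln_gt0 !fact_gt0.
Qed.

(** Evaluated on df, dg, dh, the bracket [w, w] is twice [bullet w w], and [bullet_bivector] expands
    the latter into the three terms of the Jacobi identity. *)
Lemma hamiltonian_lie f g :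
  poisson w -> forall h, lie (hamiltonian w f) (hamiltonian w g) h =
    hamiltonian w (hamiltonian w f g) h.
Proof.
move=> Jw h; pose x (i : 'I_3) := nth 0 [:: f; g; h] i.
have := congr1 (fun Q => Q x) Jw.
rewrite /schouten.
have -> : x \o cast_ord (congr1 predn (addnC 2 2)) = x.
  by apply/funext => i; rewrite /= cast_ord_id.
rewrite -signr_odd scale1r -mulr2n -scaler_nat => /(congr1 (fun v => 2%:R^-1 *: v)).
rewrite scaler0 scalerA mulVf ?pnatr_eq0 // scale1r.
rewrite (bullet_bivector _ (@bvP _ _ _ w)) !big_ord_recl big_ord0 !bivectorE.
rewrite /= /x /= addr0 /bump !leq0n !add1n expr0 expr1 sqrrN expr1n !scale1r scaleN1r.
have wC a b : w (fcons a (fun=> b)) = - w (fcons b (fun=> a)) := hamiltonianC a b.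
rewrite (wC _ f) (wC _ g) opprK addrA => /eqP; rewrite addrC addr_eq0 => /eqP ->.
by rewrite opprD opprK.
Qed.

End PoissonBracket.

(** * Local generators and involutivity of the characteristic distribution *)

Section Involutivity.
Context {R : realType} {n : nat} {Z : manifold R n}.
Implicit Types (X Y : vector_field Z) (f g h : smooth Z).

Definition evaluation (p : Z) (f : smooth Z) : R := f p.

Lemma evaluation_additive p : zmod_morphism (evaluation p).
Proof. by []. Qed.

Lemma evaluation_multiplicative p : monoid_morphism (evaluation p).
Proof. by []. Qed.

HB.instance Definition _ p :=
  GRing.isZmodMorphism.Build _ _ (evaluation p) (evaluation_additive p).
HB.instance Definition _ p :=
  GRing.isMonoidMorphism.Build _ _ (evaluation p) (evaluation_multiplicative p).

Lemma smooth_sumE p I (r : seq I) (P : pred I) (F : I -> smooth Z) :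
  (\sum_(i <- r | P i) F i) p = \sum_(i <- r | P i) F i p.
Proof. exact: (raddf_sum (evaluation p)). Qed.

Lemma tangent_combE p I (r : seq I) (P : pred I) (c : I -> R)
    (v : I -> tangent p) h :
  (\sum_(i <- r | P i) c i *: v i) h = \sum_(i <- r | P i) c i * v i h.
Proof. by elim/big_rec2: _ => // i a b _ <-. Qed.

Variable w : bivector Z.

Lemma hamiltonian_char f p : at_point p (hamiltonian w f) \in char_pred w (p := p).
Proof. by apply/asboolP; exists (differential p f); rewrite sharp_atE. Qed.

Definition char_hamiltonian f : char_field w := CharField (hamiltonian_char f).

Lemma char_combE p I (r : seq I) (P : pred I) (c : I -> R)
    (v : I -> char_tangent w p) h :
  chval (\sum_(i <- r | P i) c i *: v i) h = \sum_(i <- r | P i) c i * chval (v i) h.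
Proof. by elim/big_rec2: _ => // i a b _ <-. Qed.

Lemma char_tangentP p (u v : char_tangent w p) :
  (forall h, chval u h = chval v h) -> u = v.
Proof. by move=> uv; apply/val_inj/val_inj/funext => h; exact: uv. Qed.

Lemma hamiltonian_combl p I (r : seq I) (P : pred I) (c : I -> R)
    (f : I -> smooth Z) h :
  hamiltonian w (\sum_(i <- r | P i) (c i *: f i : smooth Z)) h p =
  \sum_(i <- r | P i) c i * hamiltonian w (f i) h p.
Proof.
rewrite hamiltonianC vf_sum smoothNE smooth_sumE -sumrN; apply: eq_bigr => i _.
by rewrite vfZ smoothZE hamiltonianC smoothNE mulrN opprK.
Qed.

(** Entries are taken in the ring of smooth functions, so that the determinant and the adjugate are
    smooth as well. *)
Definition bracket_mx k (f : 'I_k -> smooth Z) : 'M[smooth Z]_k :=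
  \matrix_(i, j) hamiltonian w (f i) (f j).

Lemma det_bracket_mx k (f : 'I_k -> smooth Z) p :
  (\det (bracket_mx f)) p = \det (\matrix_(i, j) hamiltonian w (f i) (f j) p).
Proof.
rewrite -[LHS]/(evaluation p _) -det_map_mx; congr (\det _).
by apply/matrixP => i j; rewrite !mxE.
Qed.

(** This is nondegeneracy of w along the leaves. Basis vectors of T_pF are values of Hamiltonian
    fields of some [f i]. If [v] is in the left kernel of the matrix at p, then [h], the sum of the
    [v i * f i], is killed at p by all these fields, hence by every Hamiltonian field. By
    antisymmetry the field of [h] vanishes at p, and uniqueness of coordinates gives [v = 0]. *)
Lemma char_basis p k : has_dimension (char_tangent w p) k ->
  exists f : 'I_k -> smooth Z, (\det (bracket_mx f)) p != 0.
Proof.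
move=> [e He]; have ce i : exists f, chval (e i) = at_point p (hamiltonian w f).
  by case/asboolP: (valP (e i)) => xi ->; exists (potential xi).
have [f fE] := choice ce; exists f.
rewrite det_bracket_mx; apply/det0P => -[v v0 vM].
pose h := \sum_i (v 0 i *: f i : smooth Z).
have hf j : hamiltonian w (f j) h p = 0.
  rewrite hamiltonianC smoothNE hamiltonian_combl.
  have /rowP/(_ j) := vM; rewrite !mxE => vMj; rewrite -[RHS]oppr0 -[in RHS]vMj.
  by congr (- _); apply: eq_bigr => i _; rewrite !mxE.
have hg g : hamiltonian w g h p = 0.
  have [c [cE _]] := He (char_at_point p (char_hamiltonian g)).
  have /= -> := congr1 (fun u => chval u h) cE.
  by rewrite char_combE big1 // => i _; rewrite fE /= -[w _]/(hamiltonian _ _ _) hf mulr0.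
have [c [_ cU]] := He 0.
have c0 : c = fun=> 0.
  by apply: cU; rewrite big1 // => i _; rewrite scale0r.
have cv : c = v 0.
  apply: cU; apply: char_tangentP => g; rewrite char_combE -[LHS]/0.
  transitivity (hamiltonian w h g p); first by rewrite hamiltonianC smoothNE hg oppr0.
  by rewrite hamiltonian_combl; apply: eq_bigr => i _; rewrite fE.
by move/eqP: v0; apply; apply/rowP => i; rewrite mxE -cv c0.
Qed.

(** A linear relation at p between the fields of the [f i] would be a relation between the rows of
    the bracket matrix. So these k vectors are independent and form a basis of T_pF; [B] is their
    transition matrix from [e]. *)
Lemma char_span p k (f : 'I_k -> smooth Z) (v : tangent p) :
  has_dimension (char_tangent w p) k -> (\det (bracket_mx f)) p != 0 ->
  v \in char_pred w (p := p) ->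
  exists c : 'rV[R]_k, forall h, v h = \sum_i c 0 i * hamiltonian w (f i) h p.
Proof.
move=> [e He]; rewrite det_bracket_mx => detM vc.
have coordE (u : char_tangent w p) : exists c : 'rV[R]_k, u = \sum_i c 0 i *: e i.
  have [c [-> _]] := He u; exists (\row_i c i).
  by apply: eq_bigr => i _; rewrite mxE.
have [A AE] := choice (fun i => coordE (char_at_point p (char_hamiltonian (f i)))).
pose B : 'M[R]_k := \matrix_i A i.
have fE i h : hamiltonian w (f i) h p = \sum_j B i j * chval (e j) h.
  have /= -> := congr1 (fun u => chval u h) (AE i).
  by rewrite char_combE; apply: eq_bigr => j _; rewrite mxE.
have combE (x : 'rV[R]_k) h : \sum_i x 0 i * hamiltonian w (f i) h p =
    \sum_j (x *m B) 0 j * chval (e j) h.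
  rewrite (eq_bigr (fun i => \sum_j x 0 i * (B i j * chval (e j) h))) => [|i _].
    rewrite exchange_big; apply: eq_bigr => j _ /=; rewrite mxE mulr_suml.
    by apply: eq_bigr => i _; rewrite mulrA.
  by rewrite fE mulr_sumr.
have uB : B \in unitmx.
  rewrite unitmxE unitfE; apply: contra detM => /det0P[x x0 xB].
  apply/det0P; exists x => //; apply/rowP => j; rewrite !mxE.
  rewrite (eq_bigr (fun i => x 0 i * hamiltonian w (f i) (f j) p)) => [|i _].
    by rewrite combE xB big1 // => i _; rewrite mxE mul0r.
  by rewrite mxE.
have [c cE] := coordE (CharTangent vc).
exists (c *m invmx B) => h; rewrite combE mulmxKV //.
by have /= -> := congr1 (fun u => chval u h) cE; rewrite char_combE.
Qed.

(* Cramer's rule expresses det M * Y, M the matrix of the brackets {f_i, f_j},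
   through the Hamiltonian fields of the f_i wherever det M does not vanish; the
   second factor det M makes the identity hold at every point. *)
Lemma char_field_generators k p :
  (forall q, has_dimension (char_tangent w q) k) ->
  exists (a : smooth Z) (f : 'I_k -> smooth Z), a p != 0 /\
    forall Y : char_field w, exists e : 'I_k -> smooth Z,
      forall h, a * Y h = \sum_j e j * hamiltonian w (f j) h.
Proof.
move=> dimk; have [f Dp] := char_basis (dimk p).
pose M := bracket_mx f; pose D := \det M.
exists (D * D), f; split; first by rewrite smoothME mulf_neq0.
move=> Y; exists (fun j => D * \sum_l Y (f l) * (\adj M) l j) => h.
apply/val_inj/funext => q; rewrite -[LHS]/((_ * _ : smooth Z) q).
rewrite -[RHS]/((\sum_j _ : smooth Z) q).
rewrite smooth_sumE !smoothME.
have [Dq|Dq] := eqVneq (D q) 0.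
  by rewrite Dq !mul0r big1 // => j _; rewrite !smoothME Dq !mul0r.
have [c cE] := char_span (dimk q) Dq (chfP Y q).
have YE g : Y g q = \sum_i c 0 i * hamiltonian w (f i) g q := cE g.
(* At q the row of the [Y (f l)] is [c] times [M], so multiplying by the adjugate gives [D q] times
   [c]. *)
have coefE j : (\sum_l Y (f l) * (\adj M) l j) q = c 0 j * D q.
  rewrite smooth_sumE.
  rewrite (eq_bigr (fun l => \sum_i c 0 i * (M i l * (\adj M) l j) q)) => [|l _].
    rewrite exchange_big /=.
    rewrite (eq_bigr (fun i => c 0 i * ((M *m \adj M) i j) q)) => [|i _].
      rewrite (bigD1 j) //= big1 => [|i ij]; rewrite mul_mx_adj mxE.
        by rewrite eqxx mulr1n addr0.
      by rewrite (negPf ij) mulr0n mulr0.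
    by rewrite mxE smooth_sumE mulr_sumr.
  rewrite smoothME YE mulr_suml; apply: eq_bigr => i _.
  by rewrite smoothME [M i l]mxE mulrA.
rewrite YE mulr_sumr; apply: eq_bigr => j _.
by rewrite !smoothME coefE; ring.
Qed.

(** By the Leibniz rule, [X, aY] is X(a) Y + a [X, Y], and it is also the sum of the X(e_j) H_j +
    e_j [X, H_j]. All terms but a [X, Y] lie in TF at p, and [a p] is invertible. *)
Lemma lie_char_span X (Y : char_field w) p k (a : smooth Z) (e f : 'I_k -> smooth Z) :
  a p != 0 -> (forall h, a * Y h = \sum_j e j * hamiltonian w (f j) h) ->
  (forall j, at_point p (lie X (hamiltonian w (f j))) \in char_pred w (p := p)) ->
  at_point p (lie X Y) \in char_pred w (p := p).
Proof.
move=> ap YE Xf; pose H j := hamiltonian w (f j).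
suff -> : at_point p (lie X Y) = (a p)^-1 *:
    (\sum_j X (e j) p *: at_point p (H j) +
     \sum_j e j p *: at_point p (lie X (H j)) - X a p *: at_point p Y).
  apply/rpredZ/rpredB; last exact/rpredZ/chfP.
  by apply: rpredD; apply: rpred_sum => j _;
    apply: rpredZ; do ?[exact: hamiltonian_char|exact: Xf].
apply/val_inj/funext => h; rewrite -[RHS]/((a p)^-1 * (
  (\sum_j X (e j) p *: at_point p (H j)) h +
  (\sum_j e j p *: at_point p (lie X (H j))) h - X a p * Y h p)) !tangent_combE.
apply: (mulfI ap); rewrite mulrA mulfV // mul1r.
have := congr1 (fun g : smooth Z => X g p) (YE h).
have := congr1 (fun g : smooth Z => g p) (YE (X h)).
rewrite vf_sum vfM !smooth_sumE !smoothE => E1 E2.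
rewrite -[LHS]/(a p * (X (Y h) p - Y (X h) p)) mulrBr E1.
rewrite [a p * _](canRL (addrK _) E2).
rewrite (eq_bigr (fun j => e j p * X (H j h) p + X (e j) p * H j h p)) => [|j _]; last first.
  by rewrite vfM !smoothE mulrC; ring.
rewrite addrAC [Y h p * _]mulrC; congr (_ - _).
rewrite -sumrB -big_split; apply: eq_bigr => j _.
rewrite -[(e j * _) p]/(e j p * H j (X h) p).
rewrite -[RHS]/(X (e j) p * H j h p + e j p * (X (H j h) p - H j (X h) p)).
by rewrite mulrBr addrCA addrA.
Qed.

(** Generators replace one argument at a time: [ham_char] treats a Hamiltonian field against a
    section, where the Jacobi identity settles the brackets with generators; antisymmetry then
    reduces the general case to it. *)
Lemma char_involutive (X Y : char_field w) p : poisson w -> regular w ->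
  at_point p (lie X Y) \in char_pred w (p := p).
Proof.
move=> Jw [k dimk]; have [a [f [ap gen]]] := char_field_generators p dimk.
have ham_char g (V : char_field w) :
    at_point p (lie (hamiltonian w g) V) \in char_pred w (p := p).
  have [e Ve] := gen V; apply: (lie_char_span ap Ve) => j.
  rewrite [at_point _ _](_ : _ = at_point p (hamiltonian w (hamiltonian w g (f j)))).
    exact: hamiltonian_char.
  by apply/val_inj/funext => h; rewrite -[LHS]/(lie _ _ h p) hamiltonian_lie.
have [e Ye] := gen Y; apply: (lie_char_span ap Ye) => j.
rewrite [at_point _ _](_ : _ = - at_point p (lie (hamiltonian w (f j)) X)).
  by rewrite rpredN ham_char.
by apply/val_inj/funext => h; rewrite -[LHS]/(lie _ _ h p) -[RHS]/(- lie _ _ h p) /= opprB.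
Qed.

End Involutivity.

(** * Cochain morphisms and the induced maps on cohomology *)

Section CochainMorphisms.
Context {R : pzRingType}.
Implicit Types C D : complex R.

Lemma cochain_morphism_comp C D D' (f : forall r, ambient C r -> ambient D r)
    (g : forall r, ambient D r -> ambient D' r) :
  cochain_morphism f -> cochain_morphism g ->
  cochain_morphism (fun r x => g r (f r x)).
Proof.
move=> [lf cf df bf] [lg cg dg bg]; split=> [r a x y|r x /cf/cg//|r x xC|x /bf/bg//].
  by rewrite lf lg.
by rewrite df // dg // cf.
Qed.

Lemma cohomology_class_eq C r (x y : cocycle C r) :
  is_coboundary (cyval x - cyval y) -> cohomology_class x = cohomology_class y.
Proof. by move=> bxy; apply/eqP; rewrite -Quotient.idealrBE; exact/asboolP. Qed.

Lemma cohomology_class_coboundary C r (x y : cocycle C r) :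
  cohomology_class x = cohomology_class y -> is_coboundary (cyval x - cyval y).
Proof. by move/eqP; rewrite -Quotient.idealrBE => /asboolP. Qed.

Variables (C D : complex R) (f : forall r, ambient C r -> ambient D r).
Arguments f : clear implicits.
Hypothesis mf : cochain_morphism f.

Lemma cochain_morphismB r : {morph f r : x y / x - y}.
Proof.
have [lf _ _ _] := mf => x y.
by rewrite addrC -scaleN1r lf scaleN1r addrC.
Qed.

Lemma cochain_morphism0 r : f r 0 = 0.
Proof. by rewrite -[in LHS](subrr 0) cochain_morphismB subrr. Qed.

Lemma cocycle_image r (x : cocycle C r) : f r x \in @cocycle_pred _ D r.
Proof.
have [_ cf df _] := mf; have /andP[cx /eqP dx] := valP x.
by apply/andP; split; [exact: cf|rewrite -df // dx cochain_morphism0].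
Qed.

Lemma coboundary_image r (x : ambient C r) : is_coboundary x -> is_coboundary (f r x).
Proof.
have [_ cf df _] := mf.
case: r x => [x /= -> |r x [y cy ->]]; first exact: cochain_morphism0.
by exists (f r y); [exact: cf|rewrite df].
Qed.

(** The map is computed on the representative [repr h]. Another representative differs from it by a
    coboundary, which [f] sends to a coboundary; this is [FE], and linearity follows from it. *)
Lemma induced_exists r : exists F, induced_by f (r := r) F.
Proof.
pose m (x : cocycle C r) : cocycle D r := Cocycle (cocycle_image x).
pose F (h : cohomology C r) : cohomology D r := cohomology_class (m (repr h)).
have FE x : F (cohomology_class x) = cohomology_class (m x).
  apply: cohomology_class_eq; rewrite -cochain_morphismB; apply: coboundary_image.
  by apply: cohomology_class_coboundary; rewrite class_repr.
exists F; split=> [a h k|x]; last by exists (m x).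
rewrite -[h]class_repr -[k]class_repr; move: (repr h) (repr k) => x y {h k}.
have ZE C' (z : cocycle C' r) : a *: cohomology_class z = cohomology_class (a *: z).
  exact: class_scale.
rewrite ZE -class_add !FE ZE -class_add.
congr cohomology_class; apply: val_inj => /=.
by have [lf _ _ _] := mf; rewrite lf.
Qed.

End CochainMorphisms.

Lemma induced_comp (R : pzRingType) (C D D' : complex R)
    (f : forall r, ambient C r -> ambient D r)
    (g : forall r, ambient D r -> ambient D' r) r F G :
  induced_by f (r := r) F -> induced_by g (r := r) G ->
  induced_by (fun s x => g s (f s x)) (r := r) (G \o F).
Proof.
move=> [lF FE] [lG GE]; split=> [a h k|x]; first by rewrite /= lF lG.
have [y fy Fy] := FE x; have [z gz Gz] := GE y.
by exists z; rewrite /= ?fy // Fy.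
Qed.

(** * Pullback of sections along a bundle map *)

Section SectionPullback.
Context {R : realType} {n : nat} {Z : manifold R n}.

(** Used for the map w# from T*Z to TF and for the inclusion of TF in TZ; [m] is the corresponding
    map between the families of sections. *)
Lemma section_pullback (V V' : Z -> lmodType R) (E E' : Type)
    (val : forall p, E -> V p) (val' : forall p, E' -> V' p)
    (m : E' -> E) (L : forall p, V' p -> V p) r (Phi : ('I_r -> E) -> smooth Z) :
  (forall p, linear (L p)) -> (forall p e, val p (m e) = L p (val' p e)) ->
  is_section val Phi -> is_section val' (fun x => Phi (m \o x)).
Proof.
move=> lL mL sPhi p; have [phi [lphi aphi] PhiE] := sPhi p.
exists (fun x => phi (L p \o x)) => [|x]; last first.
  by rewrite PhiE; congr phi; apply/funext => i; rewrite /= mL.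
have updL x i u : L p \o upd x i u = upd (L p \o x) i (L p u).
  by apply/funext => j; rewrite /= /upd; case: eqP.
split=> [x i a u v|x i j ij xij].
  by rewrite !updL lL lphi.
by apply: (aphi _ i j) => //=; rewrite xij.
Qed.

End SectionPullback.

(** * The two factors of w# as cochain morphisms *)

Section Factorization.
Context {R : realType} {n : nat} (Z : manifold R n) (w : bivector Z).
Hypothesis w_poisson : poisson w.

Definition leafwise_sharp r (theta : ambient (leafwise w) r) :
    ambient (lichnerowicz_poisson w) r :=
  fun f => ((-1) ^+ r : R) *: theta (fun i => char_hamiltonian w (f i)).

Definition sharp_char p (xi : cotangent p) : char_tangent w p :=
  CharTangent (asboolT (ex_intro _ xi erefl) : sharp_at w xi \in char_pred w (p := p)).

Lemma leafwise_sharp_multivector r (theta : ambient (leafwise w) r) :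
  theta \in cochain (leafwise w) r -> is_multivector (leafwise_sharp theta).
Proof.
move/asboolP => sth.
have s1 : is_multivector (fun f => theta (fun i => char_hamiltonian w (f i))).
  apply: (section_pullback (m := char_hamiltonian w) (L := sharp_char) _ _ sth).
    by move=> p a xi eta; apply/val_inj; rewrite /= sharp_atZD.
  by move=> p f; apply/val_inj; rewrite /= sharp_atE.
have [s0 sZD] := is_section_submod (fun p => @differential _ _ Z p) r.
have := sZD ((-1) ^+ r) _ 0 (asboolT s1) s0.
by rewrite addr0 => /asboolP.
Qed.

Lemma char_lieE (X Y : char_field w) :
  (forall p, at_point p (lie X Y) \in char_pred w (p := p)) ->
  chf (char_lie X Y) = lie X Y.
Proof. by move=> XY; rewrite /char_lie; case: pselect. Qed.

(** The Jacobi identity makes the bracket Hamiltonian, hence tangent to TF, so [char_lie] does not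
    take its default value. *)
Lemma char_lie_hamiltonian f g p :
  char_at_point p (char_lie (char_hamiltonian w f) (char_hamiltonian w g)) =
  char_at_point p (char_hamiltonian w (hamiltonian w f g)).
Proof.
have lieE q : at_point q (lie (hamiltonian w f) (hamiltonian w g)) =
    at_point q (hamiltonian w (hamiltonian w f g)).
  by apply/val_inj/funext => h; rewrite -[LHS]/(lie _ _ h q) hamiltonian_lie.
apply/val_inj; rewrite [LHS]/= char_lieE ?lieE // => q.
by rewrite lieE hamiltonian_char.
Qed.

(** The derivative terms of the leafwise differential match [bullet w P] and the bracket terms match
    [bullet P w], where [P] is the image of [theta]. *)
Lemma leafwise_sharp_diff r (theta : ambient (leafwise w) r) :
  theta \in cochain (leafwise w) r ->
  leafwise_sharp (diff (leafwise w) theta) =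
  diff (lichnerowicz_poisson w) (leafwise_sharp theta).
Proof.
move=> cth; have mP := leafwise_sharp_multivector cth; move/asboolP: (cth) => sth.
apply/funext => f; rewrite [RHS](_ : _ = schouten w (leafwise_sharp theta) f);
  last by rewrite /= /lp_diff opprK.
rewrite /schouten.
rewrite (bullet_bivector _ _ mP) (bivector_bullet _ _ _ mP).
(* The sign in [schouten] is (-1)^(2r) = 1. *)
rewrite mul2n -signr_odd odd_double scale1r.
rewrite /leafwise_sharp /= /chevalley_eilenberg scalerDr exprS mulN1r !scaleNr.
congr (_ + _).
  (* The extra minus sign of degree r+1 is absorbed by exchanging the two arguments of [w]. *)
  rewrite scaler_sumr -sumrN; apply: eq_bigr => i _.
  rewrite -[w _]/(hamiltonian w _ _) hamiltonianC vfZ !scalerN scalerA mulrC.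
  by rewrite -scalerA.
congr (- _); rewrite scaler_sumr; apply: eq_bigr => j _.
rewrite scaler_sumr; apply: eq_bigr => i _.
rewrite scalerA mulrC -scalerA; do 2!congr (_ *: _).
apply/val_inj/funext => p; apply: (section_local sth) => k.
by case: eqP => // _; rewrite char_lie_hamiltonian.
Qed.

Lemma leafwise_sharp_morphism : cochain_morphism leafwise_sharp.
Proof.
split=> [r a theta eta|r theta cth|r theta cth|theta /asboolP bth].
- apply/funext => f; rewrite /leafwise_sharp !fctE scalerDr !scalerA.
  by rewrite [_ * a]mulrC.
- exact/asboolP/leafwise_sharp_multivector.
- exact: leafwise_sharp_diff.
- by apply/asboolP => x g; rewrite /leafwise_sharp expr0 scale1r bth.
Qed.

(** By involutivity [char_lie] is the Lie bracket of vector fields, so both differentials are given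
    by the same formula. Constants are Casimir functions because derivations kill 1. *)
Lemma restriction_morphism : regular w -> cochain_morphism (restriction w).
Proof.
move=> w_regular; split=> [//|r phi /asboolP sphi|r phi _|phi /asboolP[c ->]].
- apply/asboolP; apply: (section_pullback (m := @chf _ _ _ w)
    (L := fun p => @chval _ _ _ w p) _ _ sphi) => //.
- apply/funext => X; rewrite /restriction /= /chevalley_eilenberg.
  congr (_ + _); apply: eq_bigr => j _; apply: eq_bigr => i _.
  congr (_ *: phi _); apply/funext => k; case: eqP => // _.
  by rewrite char_lieE // => p; exact: char_involutive.
- apply/asboolP => X g; rewrite -[LHS]/(hamiltonian w (c *: (1 : smooth Z)) g).
  rewrite hamiltonianZl hamiltonianC.
  have H1 : hamiltonian w g 1 = 0.
    have := vfM (hamiltonian w g) 1 1; rewrite mulr1 mul1r => /eqP.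
    by rewrite -subr_eq subrr eq_sym => /eqP.
  by rewrite H1 oppr0 scaler0.
Qed.

End Factorization.

Theorem proposition2 (R : realType) (n : nat) (Z : manifold R n) (w : bivector Z)
    (w_poisson : poisson w) (w_regular : regular w) :
  [/\ cochain_morphism (restriction w),
      cochain_morphism (sharp w) &
      exists g : forall r, ambient (leafwise w) r -> ambient (lichnerowicz_poisson w) r,
        [/\ cochain_morphism g,
            forall r (phi : ambient (de_rham Z) r), phi \in cochain (de_rham Z) r ->
              sharp w r phi = g r (restriction w r phi) &
            forall r, exists
              (Hi : cohomology (de_rham Z) r -> cohomology (leafwise w) r)
              (Hw : cohomology (de_rham Z) r -> cohomology (lichnerowicz_poisson w) r)
              (Hg : cohomology (leafwise w) r -> cohomology (lichnerowicz_poisson w) r),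
              [/\ induced_by (restriction w) Hi, induced_by (sharp w) Hw,
                  induced_by g Hg & forall h, Hw h = Hg (Hi h)]]].
Proof.
have mi := restriction_morphism w_poisson w_regular.
have mg := leafwise_sharp_morphism w_poisson.
(* [sharp w] is the composite of the two factors by conversion, so it inherits the morphism property
   from them. *)
split=> //; first exact: cochain_morphism_comp mi mg.
exists (@leafwise_sharp _ _ _ w); split=> // r.
have [Hi iHi] := induced_exists mi r; have [Hg iHg] := induced_exists mg r.
by exists Hi, (Hg \o Hi), Hg; split=> //; exact: induced_comp iHi iHg.
Qed.
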